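(* Let $R$ be a Noetherian factorial domain and $I$ an ideal of $R$ of grade $\geq 2$. Suppose $R^{\beta}\xrightarrow{\psi}R^{\alpha}\xrightarrow{\varepsilon}I\to 0$ is a finite free presentation of $I$, and let $B$ be a matrix representing $\psi$. Let $C$ be any $\alpha\times(\alpha-1)$ submatrix of $B$ of maximal rank $\alpha-1$. Then there exists a unique element $x\in R$ such that $I=(1/x)I_{\alpha-1}(C)$.
   Context: The matrix $B$ representing $\psi: R^{\beta}\to R^{\alpha}$ has size $\alpha\times\beta$. $I_{t}(C)$ denotes the ideal of $R$ generated by the $t$-minors of the matrix $C$. For an ideal $J$ of $R$, $(1/x)J$ denotes the set $\{y/x\mid y\in J\}$ in the fraction field of $R$.
   Formalization: The element x is shown to be unique only up to multiplication by a unit of R, since literal uniqueness fails whenever R has a unit other than 1 (for example x and -x both work when R = I = Z); x is taken nonzero so that 1/x makes sense. *)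

(* Defs.v *)
From mathcomp Require Import all_boot all_order all_algebra.
From mathcomp Require Import boolp classical_sets.

Set Implicit Arguments.
Unset Strict Implicit.
Unset Printing Implicit Defensive.

Import GRing.Theory.
Local Open Scope ring_scope.
Local Open Scope classical_set_scope.

(* Ideals are [set R]: the ideals of ring_quotient are boolean and proper,
   whereas the unit ideal has to be allowed here. *)
Definition is_ideal (R : idomainType) (J : set R) : Prop :=
  [/\ J 0, forall x y, J x -> J y -> J (x + y) & forall a x, J x -> J (a * x)].

Definition ideal_gen (R : idomainType) (A : set R) : set R :=
  smallest (@is_ideal R) A.

Definition noetherian (R : idomainType) : Prop :=
  forall J : set R, is_ideal J -> exists s : seq R, J = ideal_gen [set` s].

Definition associated (R : idomainType) (x y : R) : Prop :=
  exists2 u : R, u \is a GRing.unit & y = u * x.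

Definition irreducible_elt (R : idomainType) (p : R) : Prop :=
  [/\ p != 0, p \isn't a GRing.unit
    & forall a b : R, p = a * b ->
        a \is a GRing.unit \/ b \is a GRing.unit].

Definition factorial_domain (R : idomainType) : Prop :=
  (forall x : R, x != 0 -> x \isn't a GRing.unit ->
     exists2 s : seq R, (forall p, p \in s -> irreducible_elt p)
                      & x = \prod_(p <- s) p)
  /\ (forall s t : seq R,
       (forall p, p \in s -> irreducible_elt p) ->
       (forall p, p \in t -> irreducible_elt p) ->
       \prod_(p <- s) p = \prod_(p <- t) p ->
       exists t' : seq R, [/\ perm_eq t t', size t' = size s
         & forall i, (i < size s)%N -> associated s`_i t'`_i]).

(* Each s_i is a nonzerodivisor on R/(s_0, ..., s_{i-1}), and R/(s) <> 0. *)
Definition regular_sequence (R : idomainType) (s : seq R) : Prop :=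
  (forall i, (i < size s)%N -> forall y : R,
     ideal_gen [set` take i s] (s`_i * y) -> ideal_gen [set` take i s] y)
  /\ ~ ideal_gen [set` s] 1.

(* grade J >= n, where grade J is the supremum of the lengths of the
   R-regular sequences in J, and the unit ideal has grade +oo. *)
Definition grade_ge (R : idomainType) (J : set R) (n : nat) : Prop :=
  J 1 \/ exists s : seq R,
    [/\ regular_sequence s, [set` s] `<=` J & (n <= size s)%N].

(* R^b --psi--> R^a --eps--> J --> 0 is exact. *)
Definition free_presentation (R : idomainType) (a b : nat) (J : set R)
    (psi : {linear 'cV[R]_b -> 'cV[R]_a}) (eps : {linear 'cV[R]_a -> R^o}) :
    Prop :=
  range eps = J /\ range psi = [set v | eps v = 0].

(* B is the matrix of psi with respect to some bases of R^b and R^a, namely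
   the columns of Q and P; P = 1, Q = 1 are the standard bases. *)
Definition represents (R : idomainType) (a b : nat) (B : 'M[R]_(a, b))
    (psi : {linear 'cV[R]_b -> 'cV[R]_a}) : Prop :=
  exists (P : 'M[R]_a) (Q : 'M[R]_b),
    [/\ P \in unitmx, Q \in unitmx
      & forall v : 'cV[R]_b, psi (Q *m v) = P *m (B *m v)].

Definition increasing (m n : nat) (f : 'I_m -> 'I_n) : Prop :=
  forall i j : 'I_m, (i < j)%N -> (f i < f j)%N.

Definition column_submatrix (R : idomainType) (a b c : nat)
    (C : 'M[R]_(a, c)) (B : 'M[R]_(a, b)) : Prop :=
  exists2 g : 'I_c -> 'I_b, increasing g & C = colsub g B.

Definition minors (R : idomainType) (t m n : nat) (C : 'M[R]_(m, n)) : set R :=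
  [set d | exists (f : 'I_t -> 'I_m) (g : 'I_t -> 'I_n),
     [/\ increasing f, increasing g & d = \det (mxsub f g C)]].

Definition minors_ideal (R : idomainType) (t m n : nat) (C : 'M[R]_(m, n)) :
    set R :=
  ideal_gen (minors t C).

Definition rank_over_domain (R : idomainType) (m n : nat) (C : 'M[R]_(m, n)) :
    nat :=
  \rank (map_mx (@tofrac R) C).

(* (1/x) J in the fraction field, meaningful for x != 0. *)
Definition inv_scale (R : idomainType) (x : R) (J : set R) :
    set {fraction R} :=
  [set tofrac y / tofrac x | y in J].

(* Main.v *)
Require Import Defs.
From mathcomp Require Import all_boot all_order all_algebra.
From mathcomp Require Import boolp classical_sets.
From mathcomp Require Import zify.

Set Implicit Arguments.
Unset Strict Implicit.
Unset Printing Implicit Defensive.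

Import GRing.Theory.
Local Open Scope ring_scope.
Local Open Scope classical_set_scope.

(** Write [e] for the row of the generators of [I] given by the presentation
    (with respect to the basis of the target in which [B] is written) and [d]
    for the row of signed maximal minors of [C].  Both rows annihilate [C] from
    the left: [e] because the presentation is a complex, [d] by Laplace
    expansion of a determinant with a repeated column
    ([signed_minors_mulC]).  Over the fraction field [C] has rank one less than
    its number of rows, so its left kernel is a line, and [d] and [e], which
    are both nonzero, are proportional: [d_i e_j = e_i d_j]
    ([signed_minors_proportional]).

    Grade at least 2 makes the factor of proportionality an element of [R].
    Indeed [I] contains a nonzero [a] and an element [b] regular modulo [a]
    ([grade_ge2_regular_pair]).  If [a = e u] and [b = e v] then proportionality
    gives [b (d u) = a (d v)], so [d u = a x] for some [x] in [R], and
    [a d_i = e_i (d u)] becomes [d_i = x e_i] ([proportional_row_multiple]).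
    Hence [d = x e], that is [x I] is the ideal of maximal minors of [C].

    The same pair gives uniqueness: if [x I] is contained in [x' I] then
    [x a = x' a'] and [x b = x' b'] imply [b a' = a b'], so [a] divides [a'] and
    [x'] divides [x] ([scaled_set_dvd]); the converse is symmetric. *)

(** * Generated ideals *)

Lemma ideal_gen_is_ideal (R : idomainType) (A : set R) :
  is_ideal (ideal_gen A).
Proof.
split=> [J [[]] //|x y Ax Ay J JA|a x Ax J JA].
  by case: (JA) => -[_ JD _] _; apply: JD; [apply: Ax|apply: Ay].
by case: (JA) => -[_ _ JM] _; apply: JM; apply: Ax.
Qed.

Lemma ideal_gen_sub (R : idomainType) (A J : set R) :
  is_ideal J -> A `<=` J -> ideal_gen A `<=` J.
Proof. by move=> idJ AJ x; apply. Qed.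

Lemma sub_ideal_gen (R : idomainType) (A : set R) : A `<=` ideal_gen A.
Proof. by move=> x Ax J [_]; apply. Qed.

Lemma ideal_sum (R : idomainType) (J : set R) (T : finType) (F : T -> R) :
  is_ideal J -> (forall i, J (F i)) -> J (\sum_i F i).
Proof. by case=> J0 JD _ JF; elim/big_ind: _. Qed.

Lemma scaled_ideal (R : idomainType) (x : R) (J : set R) :
  is_ideal J -> is_ideal [set x * y | y in J].
Proof.
case=> J0 JD JM; split=> [|_ _ [y Jy <-] [z Jz <-]|a _ [y Jy <-]].
- by exists 0; rewrite ?mulr0.
- by exists (y + z); [apply: JD|rewrite mulrDr].
- by exists (a * y); [apply: JM|rewrite mulrCA].
Qed.

Lemma ideal_gen_nil (R : idomainType) :
  ideal_gen [set` [::]] = [set 0 : R].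
Proof.
apply/seteqP; split=> [|_ ->]; last by case: (ideal_gen_is_ideal [set` [::] : seq R]).
apply: ideal_gen_sub => //; split=> // [x y -> ->|a x ->].
  by rewrite addr0.
by rewrite mulr0.
Qed.

Lemma ideal_gen_seq1 (R : idomainType) (a : R) :
  ideal_gen [set` [:: a]] = [set a * y | y in setT].
Proof.
apply/seteqP; split=> [|_ [y _ <-]].
  apply: ideal_gen_sub => [|x /=]; first by apply: scaled_ideal.
  by rewrite inE => /eqP ->; exists 1; rewrite ?mulr1.
case: (ideal_gen_is_ideal [set` [:: a]]) => _ _ genM.
by rewrite mulrC; apply: genM; apply: sub_ideal_gen; rewrite /= inE.
Qed.

(** * Regular pairs *)

(** A nonzero [a], with [b] a nonzerodivisor modulo [a].  In contrast to a
    regular sequence, the quotient by [(a, b)] may vanish, so that [1, 1] is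
    such a pair and the unit ideal falls under the same treatment. *)
Definition regular_pair (R : idomainType) (a b : R) : Prop :=
  a != 0 /\ forall y z, b * y = a * z -> exists c, y = a * c.

Lemma grade_ge2_regular_pair (R : idomainType) (J : set R) :
  grade_ge J 2 -> exists a b, [/\ J a, J b & regular_pair a b].
Proof.
case=> [J1|[s]].
  exists 1, 1; split=> //; split=> [|y z _]; first exact: oner_neq0.
  by exists y; rewrite mul1r.
case: s => [|a [|b s]] [[reg _] sJ] // _.
exists a, b; split; [by apply: sJ; rewrite /= !inE eqxx
                    |by apply: sJ; rewrite /= !inE eqxx orbT|split].
  apply/eqP => a0; have := reg 0 isT 1; rewrite /= ideal_gen_nil a0 mul0r.
  by move=> /(_ erefl) /eqP; rewrite oner_eq0.
move=> y z byaz.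
have := reg 1 isT y; rewrite (_ : take 1 _ = [:: a]) /=; last by case: (s).
by rewrite ideal_gen_seq1; case=> [|c _ <-]; [exists z|exists c].
Qed.

(** An ideal containing a regular pair determines its scalings up to a unit:
    [a'] and [b'] with [x a = x' a'], [x b = x' b'] satisfy [b a' = a b'],
    whence [a' = a c] and [x = c x']. *)
Lemma scaled_set_dvd (R : idomainType) (J : set R) (a b x x' : R) :
  J a -> J b -> regular_pair a b -> x' != 0 ->
  [set x * y | y in J] `<=` [set x' * y | y in J] -> exists c, x = c * x'.
Proof.
move=> Ja Jb [a0 reg] x'0 sub.
have [a' _ xa] : [set x' * y | y in J] (x * a) by apply: sub; exists a.
have [b' _ xb] : [set x' * y | y in J] (x * b) by apply: sub; exists b.
have [|c ac] := reg a' b'.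
  apply: (mulfI x'0).
  by rewrite mulrCA xa [RHS]mulrCA xb mulrCA [RHS]mulrCA (mulrC a).
exists c; apply: (mulIf a0).
by rewrite -xa ac mulrCA [LHS]mulrC [c * x']mulrC.
Qed.

(** The vanishing of the 2-minors only says that [d] is a multiple of [e] over the
    fraction field.  Its numerator [d u] and denominator [e u] satisfy
    [(e v) (d u) = (e u) (d v)], and regularity of the pair clears the
    denominator. *)
Lemma proportional_row_multiple (R : idomainType) m (d e : 'rV[R]_m)
    (u v : 'cV[R]_m) :
  regular_pair ((e *m u) 0 0) ((e *m v) 0 0) ->
  (forall i j, d 0 i * e 0 j = e 0 i * d 0 j) -> exists x, d = x *: e.
Proof.
move=> [eu0 reg] de.
have de_mul i (w : 'cV_m) : d 0 i * (e *m w) 0 0 = e 0 i * (d *m w) 0 0.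
  rewrite ![(_ *m w) 0 0]mxE !mulr_sumr; apply: eq_bigr => j _.
  by rewrite mulrA de mulrA.
have [|x du] := reg ((d *m u) 0 0) ((d *m v) 0 0).
  rewrite [LHS]mulrC ![(_ *m u) 0 0]mxE !mulr_suml; apply: eq_bigr => i _.
  by rewrite mulrAC de_mul mulrAC.
exists x; apply/rowP=> i; rewrite mxE; apply: (mulIf eu0).
by rewrite de_mul du mulrA [LHS]mulrC mulrA.
Qed.

(** * Maximal minors of an (n+1) x n matrix *)

Definition signed_minors (R : comPzRingType) n (C : 'M[R]_(n.+1, n)) :
  'rV[R]_n.+1 := \row_i ((-1) ^+ i * \det (row' i C)).

(** Laplace expansion along [c]: the linear form with coefficients the signed
    minors is the determinant as a function of an adjoined column. *)
Lemma signed_minors_mul (R : comNzRingType) n (C : 'M[R]_(n.+1, n))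
    (c : 'cV[R]_n.+1) :
  (signed_minors C *m c) 0 0 = \det (row_mx c C : 'M_(1 + n)).
Proof.
rewrite (expand_det_col _ (lshift n 0)) mxE; apply: eq_bigr => i _.
rewrite row_mxEl mxE mulrC /cofactor addn0; congr (_ * (_ * \det _)).
apply/matrixP=> j k; rewrite !mxE; case: splitP => l /= lE.
  by case: l lE => -[].
by congr (C _ _); apply: val_inj; move: lE; rewrite /bump /= => -[].
Qed.

(** Adjoining to [C] one of its own columns gives determinant zero. *)
Lemma signed_minors_mulC (R : comNzRingType) n (C : 'M[R]_(n.+1, n)) :
  signed_minors C *m C = 0.
Proof.
apply/matrixP=> i j; rewrite ord1 [RHS]mxE.
transitivity ((signed_minors C *m col j C) 0 0).
  by rewrite !mxE; apply: eq_bigr => k _; rewrite [col j C k 0]mxE.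
rewrite signed_minors_mul -det_tr.
apply: (determinant_alternate (i1 := lshift n ord0)
                              (i2 := rshift 1 j)) => [|k].
  by rewrite eq_lrshift.
by rewrite !mxE (unsplitK (inl _)) (unsplitK (inr _)) mxE.
Qed.

Lemma map_signed_minors (R S : comNzRingType) (f : {rmorphism R -> S}) n
    (C : 'M[R]_(n.+1, n)) :
  signed_minors (map_mx f C) = map_mx f (signed_minors C).
Proof.
apply/rowP=> i; rewrite !mxE rmorphM rmorphXn rmorphN1 -det_map_mx.
by congr (_ * \det _); apply/matrixP=> j k; rewrite !mxE.
Qed.

Lemma left_kernel_line (K : fieldType) n (C : 'M[K]_(n.+1, n))
    (e u : 'rV[K]_n.+1) :
  \rank C = n -> e != 0 -> e *m C = 0 -> u *m C = 0 ->
  exists k, u = k *: e.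
Proof.
move=> rC e0 eC uC; apply/sub_rVP.
have /eqmxP/eqmx_sym eK : (e == kermx C)%MS.
  have sK : (e <= kermx C)%MS by apply/sub_kermxP.
  rewrite -(mxrank_leqif_eq sK) mxrank_ker rC rank_rV e0.
  by rewrite subSnn.
by rewrite -eK; apply/sub_kermxP.
Qed.

(** If [e_i] is nonzero, the [i]-th minor is too: [e] spans the left kernel of
    [C] and does not annihilate the [i]-th standard column, so adjoining this
    column to [C] makes it invertible, with the [i]-th signed minor as
    determinant. *)
Lemma signed_minors_neq0 (K : fieldType) n (C : 'M[K]_(n.+1, n))
    (e : 'rV[K]_n.+1) :
  \rank C = n -> e != 0 -> e *m C = 0 -> signed_minors C != 0.
Proof.
move=> rC e0 eC.
have [i ei0] : exists i, e 0 i != 0.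
  by case/rV0Pn: e0 => i; exists i.
pose M : 'M_(1 + n) := row_mx (delta_mx i 0) C.
have: M \in unitmx.
  rewrite -row_free_unit; apply: inj_row_free => u.
  rewrite mul_mx_row -[RHS]row_mx0 => /eq_row_mx[ui uC].
  have [k uE] := left_kernel_line rC e0 eC uC.
  move/matrixP/(_ 0 0)/eqP: ui; rewrite -colE !mxE uE mxE mulf_eq0.
  by rewrite (negPf ei0) orbF => /eqP ->; rewrite scale0r.
rewrite unitmxE unitfE -signed_minors_mul; apply: contraNneq => ->.
by rewrite mul0mx mxE.
Qed.

Lemma signed_minors_proportional (R : idomainType) n (C : 'M[R]_(n.+1, n))
    (e : 'rV[R]_n.+1) :
  rank_over_domain C = n -> e != 0 -> e *m C = 0 ->
  signed_minors C != 0 /\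
  forall i j, signed_minors C 0 i * e 0 j = e 0 i * signed_minors C 0 j.
Proof.
pose f : {rmorphism R -> {fraction R}} := @tofrac R.
have f_inj : injective f by move=> x y /eqP; rewrite tofrac_eq => /eqP.
move=> rC e0 eC.
have fe0 : map_mx f e != 0.
  case/rV0Pn: e0 => i ei0; apply/rV0Pn; exists i.
  by rewrite mxE tofrac_eq0.
have feC : map_mx f e *m map_mx f C = 0 by rewrite -map_mxM eC map_mx0.
have := signed_minors_neq0 rC fe0 feC; rewrite map_signed_minors => fd0.
split; first by apply: contraNneq fd0 => ->; rewrite map_mx0.
move=> i j; apply: f_inj; rewrite !rmorphM.
have [|k /rowP dE] := left_kernel_line (u := map_mx f (signed_minors C)) rC fe0 feC.
  by rewrite -map_mxM signed_minors_mulC map_mx0.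
by have := dE i; have := dE j; rewrite !mxE => -> ->; rewrite mulrCA mulrA.
Qed.

(** * Increasing maps and the ideal of maximal minors *)

Lemma increasing_lift n (i : 'I_n.+1) : increasing (lift i).
Proof. by move=> j k jk; rewrite ltnNge /= leq_bump2 -ltnNge. Qed.

Lemma increasing_ge m n (f : 'I_m -> 'I_n) :
  increasing f -> forall i : 'I_m, (i <= f i)%N.
Proof.
move=> finc [i]; elim: i => // i IH im.
by apply: leq_ltn_trans (IH (ltnW im)) _; apply: finc => /=.
Qed.

Lemma increasing_inj m n (f : 'I_m -> 'I_n) : increasing f -> injective f.
Proof.
move=> finc i j fij; apply: val_inj; case: (ltngtP i j) => // /finc;
  by rewrite fij ltnn.
Qed.

(** An increasing map is bounded below by the identity; conjugating by the
    order reversal bounds an endomap above as well. *)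
Lemma increasing_endo_id n (f : 'I_n -> 'I_n) : increasing f -> f =1 id.
Proof.
move=> finc i; apply: val_inj => /=.
have revf_inc : increasing (@rev_ord n \o f \o @rev_ord n).
  have rev_lt (k l : 'I_n) : (k < l)%N -> (rev_ord l < rev_ord k)%N.
    by move=> kl; rewrite /= ltn_sub2l // (leq_ltn_trans kl).
  by move=> j k jk; apply/rev_lt/finc/rev_lt.
have := increasing_ge revf_inc (rev_ord i); rewrite /= rev_ordK.
have := increasing_ge finc i; have := ltn_ord i; have := ltn_ord (f i).
lia.
Qed.

(** The image misses some [i], so [f] factors as [lift i] after an increasing
    endomap, which is the identity. *)
Lemma increasing_succ_lift n (f : 'I_n -> 'I_n.+1) :
  increasing f -> exists i : 'I_n.+1, f =1 lift i.
Proof.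
move=> finc; have f_inj := increasing_inj finc.
have /subsetPn[i _ iNf] : ~~ ('I_n.+1 \subset codom f).
  apply/negP=> /subset_leq_card.
  by rewrite (card_codom f_inj) !card_ord ltnn.
have h_ex k : {j | f k = lift i j}.
  have /unlift_some[j fE _] : i != f k.
    by apply: contraNneq iNf => ->; apply: codom_f.
  by exists j.
exists i => k; case: (h_ex k) => j fk; rewrite fk; congr lift.
pose h k := sval (h_ex k).
have hE k' : f k' = lift i (h k') by rewrite /h; case: (h_ex k').
have hinc : increasing h.
  by move=> l m /finc; rewrite !hE /= !ltnNge leq_bump2.
by apply: (@lift_inj _ i); rewrite -fk hE (increasing_endo_id hinc).
Qed.

Lemma minors_pred (R : idomainType) n (C : 'M[R]_(n.+1, n)) :
  minors n C = range (fun i => \det (row' i C)).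
Proof.
apply/seteqP; split=> [d [f [g [/increasing_succ_lift[i fE]]]]|_ [i _ <-]].
  move=> /increasing_endo_id gE ->; exists i => //.
  by congr (\det _); apply/matrixP=> j k; rewrite !mxE fE gE.
by exists (lift i), id; split=> //; apply: increasing_lift.
Qed.

(** Signs do not matter for the ideal, and with signs the combinations of the
    minors are the values of a linear form, ready to be compared with [eps]. *)
Lemma minors_ideal_pred (R : idomainType) n (C : 'M[R]_(n.+1, n)) :
  minors_ideal n C = range (fun w : 'cV_n.+1 => (signed_minors C *m w) 0 0).
Proof.
have [_ _ genM] := ideal_gen_is_ideal (minors n C).
apply/seteqP; split=> [|_ [w _ <-]].
  apply: ideal_gen_sub.
    split=> [|_ _ [v _ <-] [w _ <-]|a _ [w _ <-]].
    - by exists 0 => //; rewrite mulmx0 mxE.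
    - by exists (v + w) => //; rewrite mulmxDr mxE.
    - by exists (a *: w) => //; rewrite -scalemxAr mxE.
  rewrite minors_pred => _ [i _ <-]; exists ((-1) ^+ i *: delta_mx i 0) => //.
  by rewrite -scalemxAr -colE !mxE mulrA -signr_odd -expr2 sqrr_sign mul1r.
rewrite mxE; apply: ideal_sum (ideal_gen_is_ideal _) _ => i.
rewrite !mxE mulrAC; apply: genM; apply: sub_ideal_gen.
by rewrite minors_pred; exists i.
Qed.

(** * From the presentation to the minors *)

(** The entries of [e] are the values of [eps] on the columns of the change of
    basis [P]; as [P] is invertible they generate the same ideal, and
    [psi (Q v) = P (B v)] turns [eps \o psi = 0] into [e *m B = 0]. *)
Lemma presentation_row (R : idomainType) a b (J : set R)
    (psi : {linear 'cV[R]_b -> 'cV[R]_a}) (eps : {linear 'cV[R]_a -> R^o})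
    (B : 'M[R]_(a, b)) :
  free_presentation J psi eps -> represents B psi ->
  exists e : 'rV[R]_a,
    J = range (fun w : 'cV_a => (e *m w) 0 0) /\ e *m B = 0.
Proof.
move=> [epsJ psiK] [P [Q [Pu _ psiE]]].
pose e : 'rV[R]_a := \row_i eps (col i P).
have eE w : (e *m w) 0 0 = eps (P *m w).
  have -> : P *m w = \sum_i w i 0 *: col i P.
    apply/colP=> k; rewrite mxE summxE; apply: eq_bigr => i _.
    by rewrite !mxE mulrC.
  rewrite linear_sum mxE; apply: eq_bigr => i _.
  by rewrite linearZ mxE mulrC.
exists e; split.
  rewrite -epsJ; apply/seteqP; split=> [_ [v _ <-]|_ [w _ <-]].
    by exists (invmx P *m v) => //; rewrite eE mulKVmx.
  by exists (P *m w) => //; rewrite eE.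
apply/rowP=> j; rewrite [RHS]mxE.
transitivity ((e *m (B *m (delta_mx j 0 : 'cV_b))) 0 0).
  by rewrite mulmxA -colE [RHS]mxE.
rewrite eE -psiE.
have : range psi (psi (Q *m delta_mx j 0)) by exists (Q *m delta_mx j 0).
by rewrite psiK.
Qed.

Lemma eq_inv_scale (R : idomainType) (x : R) (J K : set R) : x != 0 ->
  [set tofrac a | a in J] = inv_scale x K <-> [set x * y | y in J] = K.
Proof.
move=> x0; have fx0 : tofrac x != 0 by rewrite tofrac_eq0.
have f_inj (y z : R) : tofrac y = tofrac z -> y = z.
  by move=> /eqP; rewrite tofrac_eq => /eqP.
have scaleE y z : tofrac y = tofrac z / tofrac x <-> x * y = z.
  split=> [yz|<-]; last by rewrite tofracM mulrAC mulfV ?mul1r.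
  by apply: f_inj; rewrite tofracM yz mulrCA mulfV ?mulr1.
split=> [JK|<-].
  apply/seteqP; split=> [_ [y Jy <-]|z Kz].
    have : inv_scale x K (tofrac y) by rewrite -JK; exists y.
    by case=> z Kz /esym/scaleE ->.
  have : [set tofrac a | a in J] (tofrac z / tofrac x) by rewrite JK; exists z.
  by case=> y Jy /scaleE <-; exists y.
apply/seteqP; split=> [_ [y Jy <-]|_ [_ [y Jy <-] <-]].
  by exists (x * y); [exists y|apply/esym/scaleE].
by exists y => //; apply/scaleE.
Qed.

Theorem theorem4p7 (R : idomainType)
    (noethR : noetherian R) (factR : factorial_domain R)
    (I : set R) (idealI : is_ideal I) (gradeI : grade_ge I 2)
    (alpha beta : nat)
    (psi : {linear 'cV[R]_beta -> 'cV[R]_alpha})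
    (eps : {linear 'cV[R]_alpha -> R^o})
    (presI : free_presentation I psi eps)
    (B : 'M[R]_(alpha, beta)) (reprB : represents B psi)
    (C : 'M[R]_(alpha, alpha.-1)) (subC : column_submatrix C B)
    (rankC : rank_over_domain C = alpha.-1) :
  exists x : R,
    [/\ x != 0,
        [set tofrac a | a in I] = inv_scale x (minors_ideal alpha.-1 C)
      & forall x' : R, x' != 0 ->
          [set tofrac a | a in I] = inv_scale x' (minors_ideal alpha.-1 C) ->
          associated x x'].
Proof.
have [e [IE eB]] := presentation_row presI reprB.
have [a [b [Ia Ib reg]]] := grade_ge2_regular_pair gradeI.
have eC : e *m C = 0.
  case: subC => g _ ->; rewrite mulmx_colsub eB.
  by apply/matrixP=> i j; rewrite !mxE.
have e0 : e != 0.
  case: reg => a0 _; apply: contraNneq a0 => e0.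
  by move: Ia; rewrite IE e0 => -[w _ <-]; rewrite mul0mx mxE.
clear presI psi eps reprB subC B eB.
case: alpha => [|n] in C e rankC IE eC e0 *.
  (* With no rows, [e] would be empty, hence zero. *)
  by case/rV0Pn: e0 => -[].
have [d0 de] := signed_minors_proportional rankC e0 eC.
have [x dE] : exists x, signed_minors C = x *: e.
  move: Ia Ib reg; rewrite {1 2}IE => -[u _ <-] [v _ <-] reg.
  exact: (proportional_row_multiple reg de).
have x0 : x != 0 by apply: contraNneq d0 => x0; rewrite dE x0 scale0r.
have xI : [set x * y | y in I] = minors_ideal n C.
  rewrite minors_ideal_pred dE IE image_comp; apply: eq_imagel => w _ /=.
  by rewrite -scalemxAl [RHS]mxE.
exists x; split=> //; first exact/eq_inv_scale.
move=> x' x'0 /(eq_inv_scale _ _ x'0) x'I.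
have [|c xc] := scaled_set_dvd (x := x) Ia Ib reg x'0; first by rewrite xI x'I.
have [|c' x'c] := scaled_set_dvd (x := x') Ia Ib reg x0; first by rewrite xI x'I.
exists c' => //; apply/unitrPr; exists c; apply: (mulIf x'0).
by rewrite -mulrA -xc -x'c mul1r.
Qed.
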